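(* Given $b>0$ and $\Delta\in\mathbb{N}$, there exists $\omega<1$ such that the following holds. Let $G_n=(V_n,E_n)$, $n\ge1$, be a sequence of finite graphs, each a vertex $b$-expander with maximum degree at most $\Delta$, with $|V_n|\to\infty$, and let $0\le p_n\le 1$ for each $n$. Then $$\mathbb{P}\big(G_n(p_n)\text{ contains more than one connected component of order at least } |V_n|^{\omega}\big)\to 0$$ as $n\to\infty$.
   Context: For a graph $G$ and $p\in[0,1]$, $G(p)$ denotes the random spanning subgraph of $G$ obtained by retaining each edge of $G$ independently with probability $p$. The order of a component is its number of vertices. For a finite graph $G=(V,E)$ and $A\subseteq V$, the external boundary $\partial A$ is the set of vertices outside $A$ having a neighbor in $A$. The vertex isoperimetric constant is $\iota(G)=\min\{|\partial A|/|A| : A\subset V,\ 0<|A|\le |V|/2\}$, and $G$ is a vertex $b$-expander if $\iota(G)\ge b$. *)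

(* Defs.v *)
From HB Require Import structures.
From mathcomp Require Import all_boot all_order all_algebra.
From mathcomp Require Import all_classical all_reals all_analysis.

Set Implicit Arguments.
Unset Strict Implicit.
Unset Printing Implicit Defensive.

Import Order.TTheory GRing.Theory Num.Theory.
Import numFieldNormedType.Exports.

Local Open Scope ring_scope.

Record sgraph := SGraph {
  vertex :> finType;
  adj : rel vertex;
  adj_sym : symmetric adj;
  adj_irrefl : irreflexive adj
}.

Section Graph.
Variable G : sgraph.
Implicit Types (x y : G) (A : {set G}) (F : {set {set G}}).

Definition degree x : nat := #|[set y | adj x y]|.
Definition max_degree : nat := \max_(x : G) degree x.

Definition edges : {set {set G}} :=
  [set [set u.1; u.2] | u : G * G & adj u.1 u.2].

Definition boundary A : {set G} :=
  [set y in ~: A | [exists x in A, adj x y]].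

Definition components : {set {set G}} :=
  equivalence_partition (connect (@adj G)) [set: G].

Definition sub_adj F : rel G := [rel x y | adj x y && ([set x; y] \in F)].

Fact sub_adj_sym F : symmetric (sub_adj F).
Proof. by move=> x y; rewrite /sub_adj /= adj_sym finset.setUC. Qed.

Fact sub_adj_irrefl F : irreflexive (sub_adj F).
Proof. by move=> x; rewrite /sub_adj /= adj_irrefl. Qed.

Definition spanning_subgraph F : sgraph :=
  SGraph (sub_adj_sym F) (sub_adj_irrefl F).

End Graph.

Section Expander.
Variable R : realType.

(* Valued in \bar R, so that the minimum over the empty family, which occurs
   only when G has at most one vertex, is +oo. *)
Definition vertex_iso_const (G : sgraph) : \bar R :=
  \big[Order.min/+oo%E]_(A : {set G} | (0 < #|A|)%N && (#|A|.*2 <= #|G|)%N)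
     (#|boundary A|%:R / #|A|%:R)%:E.

Definition vertex_expander (b : R) (G : sgraph) : Prop :=
  (b%:E <= vertex_iso_const G)%E.

End Expander.

Section Percolation.
Variables (R : realType) (G : sgraph) (p : R).

Definition perc_weight (F : {set {set G}}) : R :=
  \prod_(e in edges G) (if e \in F then p else 1 - p).

(* The probability that the random graph G(p) satisfies P. *)
Definition perc_prob (P : pred sgraph) : R :=
  \sum_(F in powerset (edges G) | P (spanning_subgraph F)) perc_weight F.

Lemma perc_prob_predT : perc_prob predT = 1.
Proof.
transitivity (\prod_(e : {set G})
  ((if e \in edges G then p else 0) + (if e \in edges G then 1 - p else 1)));
  last by rewrite big1 // => e _; case: ifP; rewrite ?add0r // addrC subrK.
rewrite bigA_distr /perc_prob [RHS](bigID [in powerset (edges G)]) /=.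
rewrite [X in _ + X]big1 ?addr0 => [|F]; last first.
  rewrite powersetE => /subsetPn[e eF eE].
  by rewrite (bigD1 e) //= eF (negbTE eE) mul0r.
apply: eq_big => [F|F]; first by rewrite andbT.
rewrite andbT powersetE => /fintype.subsetP FE.
rewrite /perc_weight big_mkcond; apply: eq_bigr => e _.
by case: ifPn => // eE; case: ifPn => // /FE; rewrite (negbTE eE).
Qed.

End Percolation.

Definition large_components (R : realType) (t : R) (G : sgraph) :
    {set {set G}} :=
  [set C in components G | t <= #|C|%:R].

(* Main.v *)
Require Import Defs.
From HB Require Import structures.
From mathcomp Require Import all_boot all_order all_algebra.
From mathcomp Require Import all_classical all_reals all_analysis.
From mathcomp Require Import fintype finset lra ring zify.

Set Implicit Arguments.
Unset Strict Implicit.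
Unset Printing Implicit Defensive.

Import Order.TTheory GRing.Theory Num.Theory.
Import numFieldNormedType.Exports.

Local Open Scope ring_scope.

(** Let [N = #|G|], [t = N `^ omega] and let [g F] be the number of pairs of
    vertices connected in [F].

    If [p] is small, counting open self-avoiding paths gives [E g <= 2 N], while a
    component of order [t] forces [g >= t ^+ 2].

    Otherwise, expansion shows that two components [A], [B] of order at least [t]
    have at least [t / 2] vertices of [A] within distance [L = O((1 - omega) ln N)]
    of [B], and opening the path [S x y] between two such vertices raises [g] by at
    least [t ^+ 2].  Since [E[g (S :|: F)] - E[g F] = p ^- #|S| * Cov(g, 1_(S \subset F))],
    summing over all pairs [x], [y] at distance at most [L] bounds
    [P(two large components) * t ^+ 3 / 2] by [Cov(g, X)] with
    [X = \sum_(x, y) p ^- #|S x y| * 1_(S x y \subset F)].  Here [0 <= g <= N ^+ 2],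
    and [Var X <= N `^ (1 + small)] because disjoint edge sets are independent, so
    the probability is at most [N `^ (5 / 2 - 3 * omega + small)]. *)

(** * Graph distance, balls and short paths *)

Section Distance.
Variable G : sgraph.
Implicit Types (x y z : G) (A B : {set G}).

(** A step may stay put, so this is distance at most [k] rather than a walk of length exactly
    [k]. *)
Fixpoint near (k : nat) x y : bool :=
  if k is k'.+1 then [exists z, near k' x z && ((z == y) || adj z y)]
  else x == y.

Lemma nearS k x y : near k x y -> near k.+1 x y.
Proof. by move=> h /=; apply/existsP; exists y; rewrite h eqxx. Qed.

Lemma near_adj k x y z : near k x y -> adj y z -> near k.+1 x z.
Proof. by move=> h a /=; apply/existsP; exists y; rewrite h a orbT. Qed.

Lemma near_trans j k x y z : near j x y -> near k y z -> near (j + k) x z.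
Proof.
move=> h; elim: k z => [|k IH] z; first by move/eqP<-; rewrite addn0.
rewrite addnS => /existsP[u /andP[/IH hu]] /orP[/eqP<-|]; first exact: nearS.
exact: near_adj.
Qed.

Lemma near_sym k x y : near k x y -> near k y x.
Proof.
elim: k y => [|k IH] y; first by rewrite /= eq_sym.
case/existsP=> u /andP[/IH hu] /orP[/eqP<-|a]; first exact: nearS.
have h1 : near 1 y u by apply: (@near_adj 0 _ y); rewrite /= ?eqxx // adj_sym.
exact: near_trans h1 hu.
Qed.

Definition nball k A : {set G} := [set y | [exists x in A, near k x y]].

Lemma card_near (D k : nat) x :
  (max_degree G <= D)%N -> (#|[set y | near k x y]| <= D.+1 ^ k)%N.
Proof.
move=> hD; elim: k => [|k IH] /=.
  rewrite expn0 -(cards1 x); apply: subset_leq_card; apply/subsetP => y.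
  by rewrite !inE eq_sym.
set B := [set y | near k x y] in IH *.
pose N z := z |: [set y | adj z y].
have hN z : (#|N z| <= D.+1)%N.
  rewrite /N cardsU1 -add1n leq_add //; first by case: (_ \in _).
  by apply: leq_trans hD; exact: (leq_bigmax z).
apply: (@leq_trans #|\bigcup_(z in B) N z|).
  apply: subset_leq_card; apply/subsetP => y; rewrite inE.
  case/existsP=> z /andP[h1 h2]; apply/bigcupP; exists z; first by rewrite inE.
  by rewrite !inE eq_sym.
apply: (@leq_trans (\sum_(z in B) #|N z|)).
  elim/big_rec2: _ => [|z m U _ hm]; first by rewrite cards0.
  by apply: leq_trans (leq_card_setU _ _) _; rewrite leq_add2l.
apply: (@leq_trans (\sum_(z in B) D.+1)); first by apply: leq_sum => z _.
by rewrite sum_nat_const expnSr leq_mul2r IH orbT.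
Qed.

(** [S] collects the edges of a walk from [x] to [y]. Confining them to the ball around [x] ensures
    that two such sets share an edge only when their starting points are close, which later limits
    the dependent pairs. *)
Lemma near_path k x y : near k x y ->
  exists S : {set {set G}},
    [/\ S \subset edges G, (#|S| <= k)%N,
        (forall e u, e \in S -> u \in e -> near k x u)
      & connect (sub_adj S) x y].
Proof.
elim: k y => [|k IH] y.
  move/eqP<-; exists set0.
  by split; rewrite ?sub0set ?cards0 // => e u; rewrite inE.
case/existsP=> z /andP[hz /orP[/eqP <-|a]].
  have [S [S1 S2 S3 S4]] := IH _ hz; exists S; split => //; first exact: leqW.
  by move=> e u eS ue; apply: nearS; exact: S3 eS ue.
have [S [S1 S2 S3 S4]] := IH _ hz; exists ([set z; y] |: S); split.
- rewrite subUset S1 andbT sub1set; apply/imsetP.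
  by exists (z, y); rewrite ?inE.
- by rewrite cardsU1 -add1n leq_add //; case: (_ \in _).
- move=> e u; rewrite in_setU1 => /orP[/eqP->|eS ue].
    by rewrite in_set2 => /orP[] /eqP->; [exact: nearS | exact: near_adj hz a].
  by apply: nearS; exact: S3 eS ue.
- apply: (@connect_trans _ _ z).
    apply: connect_sub S4 => u v /andP[h1 h2]; apply: connect1.
    by rewrite /sub_adj /= h1 in_setU1 h2 orbT.
  by apply: connect1; rewrite /sub_adj /= a in_setU1 eqxx.
Qed.

End Distance.

(** * Vertex expansion and the growth of balls *)

Section Expansion.
Variables (R : realType) (G : sgraph) (b : R).
Implicit Types (A B : {set G}).
Hypothesis (b0 : 0 < b) (expG : vertex_expander b G).

Lemma boundary_ge A : (0 < #|A|)%N -> (#|A|.*2 <= #|G|)%N ->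
  b * #|A|%:R <= #|boundary A|%:R.
Proof.
move=> A0 A2; rewrite -ler_pdivlMr ?ltr0n // -lee_fin.
apply: le_trans expG _; rewrite /vertex_iso_const.
by rewrite (bigD1 A) /= ?A0 // ge_min lexx.
Qed.

(** The next ball contains the boundary of the present one, so each step multiplies the size by at
    least [1 + b] until more than half of [G] is covered. *)
Lemma nball_growth A k : (0 < #|A|)%N ->
  (#|G| < #|nball k A|.*2)%N \/ (1 + b) ^+ k * #|A|%:R <= #|nball k A|%:R.
Proof.
move=> A0; elim: k => [|k IH].
  right; rewrite expr0 mul1r ler_nat; apply: subset_leq_card.
  apply/subsetP => x xA; rewrite inE; apply/existsP; exists x.
  by rewrite xA /=.
have sub : nball k A :|: boundary (nball k A) \subset nball k.+1 A.
  apply/subsetP => y; rewrite in_setU => /orP[|].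
    rewrite !inE => /existsP[x /andP[xA h]]; apply/existsP; exists x.
    by rewrite xA; exact: nearS.
  rewrite inE => /andP[_ /existsP[z /andP[]]].
  rewrite inE => /existsP[x /andP[xA h]] a; rewrite inE.
  by apply/existsP; exists x; rewrite xA; exact: near_adj h a.
have cardk := subset_leq_card sub.
have dis : nball k A :&: boundary (nball k A) = set0.
  apply/setP => y; rewrite !inE; case: [exists _ in _, _] => //=.
rewrite cardsU dis cards0 subn0 in cardk.
have big : (#|G| < #|nball k A|.*2)%N -> (#|G| < #|nball k.+1 A|.*2)%N.
  move=> h; apply: leq_trans h _; rewrite leq_double.
  by apply: leq_trans cardk; exact: leq_addr.
case: IH => [h|h]; first by left; exact: big.
case: (ltnP #|G| #|nball k A|.*2) => [h2|h2]; first by left; exact: big.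
right; have h0 : (0 < #|nball k A|)%N.
  rewrite -(ltr_nat R); apply: lt_le_trans h; rewrite mulr_gt0 ?ltr0n //.
  by rewrite exprn_gt0 // addr_gt0.
have := boundary_ge h0 h2; move: cardk; rewrite -(ler_nat R) natrD => h3 h4.
apply: le_trans h3; apply: (@le_trans _ _ ((1 + b) * #|nball k A|%:R)); last lra.
by rewrite exprS -mulrA ler_pM2l // addr_gt0.
Qed.

(** Were more than [t / 2] vertices of [A] far from [B], the [k]-balls around them and around [B]
    would each cover more than half of [G] and hence meet, putting one of those vertices within
    [k + k] of [B]. *)
Lemma many_near (t : R) A B k : 0 < t -> t <= #|A|%:R -> t <= #|B|%:R ->
  #|G|%:R < (1 + b) ^+ k * t ->
  t / 2 <= #|[set x in A | [exists y in B, near (k + k) x y]]|%:R.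
Proof.
move=> t0 tA tB hk; set A' := [set x in A | _].
pose A0 := A :\: A'; rewrite leNgt; apply/negP => lt.
have cA : (#|A| <= #|A'| + #|A0|)%N.
  by rewrite -(cardsID A' A) leq_add2r subset_leq_card // subsetIr.
have hA0 : t / 2 < #|A0|%:R.
  by move: cA; rewrite -(ler_nat R) natrD => cA; lra.
have bk0 : 0 < (1 + b) ^+ k by rewrite exprn_gt0 // addr_gt0.
(* Growth from more than [t / 2] vertices yields more than [#|G| / 2], so both alternatives of
   [nball_growth] give the claim. *)
have big (C : {set G}) : t / 2 < #|C|%:R -> (#|G| < #|nball k C|.*2)%N.
  move=> hC; have C0 : (0 < #|C|)%N by rewrite -(ltr_nat R); lra.
  case: (nball_growth k C0) => // h; rewrite -(ltr_nat R) -muln2 natrM.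
  apply: (lt_le_trans hk); rewrite -ler_pdivrMr //.
  by apply: le_trans h; rewrite -mulrA ler_pM2l // ltW.
have h1 := big _ hA0; have h2 : (#|G| < #|nball k B|.*2)%N by apply: big; lra.
have : nball k A0 :&: nball k B != set0.
  rewrite -card_gt0; have := cardsUI (nball k A0) (nball k B).
  have : (#|nball k A0 :|: nball k B| <= #|G|)%N by exact: max_card.
  lia.
case/set0Pn=> z; rewrite inE => /andP[].
rewrite !inE => /existsP[x /andP[xA0 xz]] /existsP[y /andP[yB yz]].
move: xA0; rewrite !inE => /andP[/negP h xA]; apply: h; rewrite xA /=.
by apply/existsP; exists y; rewrite yB; apply: near_trans xz (near_sym yz).
Qed.

End Expansion.

(** * Expectation under percolation and a covariance bound *)

Section Expectation.
Variables (R : realType) (G : sgraph) (p : R).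
Implicit Types (F S T : {set {set G}}) (h : {set {set G}} -> R).

Definition expect h : R := \sum_(F in powerset (edges G)) perc_weight p F * h F.

Lemma eq_expect h h' : h =1 h' -> expect h = expect h'.
Proof. by move=> e; apply: eq_bigr => F _; rewrite e. Qed.

Lemma expect_sum (I : Type) (r : seq I) (P : pred I) (H : I -> {set {set G}} -> R) :
  expect (fun F => \sum_(i <- r | P i) H i F) = \sum_(i <- r | P i) expect (H i).
Proof.
by rewrite /expect exchange_big; apply: eq_bigr => F _; rewrite mulr_sumr.
Qed.

Lemma expectD h h' : expect (fun F => h F + h' F) = expect h + expect h'.
Proof. by rewrite /expect -big_split; apply: eq_bigr => F _; rewrite mulrDr. Qed.

Lemma expectZ c h : expect (fun F => c * h F) = c * expect h.
Proof.
by rewrite /expect mulr_sumr; apply: eq_bigr => F _; rewrite mulrCA.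
Qed.

Lemma expectB h h' : expect (fun F => h F - h' F) = expect h - expect h'.
Proof. by rewrite -mulN1r -expectZ -expectD; apply: eq_expect => F; rewrite mulN1r. Qed.

Lemma expect_cst c : expect (fun=> c) = c.
Proof.
rewrite -[RHS]mulr1 -(perc_prob_predT G p) /expect /perc_prob mulr_sumr.
by apply: eq_big => [F|F _]; rewrite ?andbT // mulrC.
Qed.

Lemma perc_probE (P : pred sgraph) :
  perc_prob G p P = expect (fun F => (P (spanning_subgraph F))%:R).
Proof.
rewrite /perc_prob /expect big_mkcondr; apply: eq_bigr => F _.
by case: (P _); rewrite ?mulr1 ?mulr0.
Qed.

(** Sets come in pairs [F], [F :\ e] with [e \in F], of weights [p * w] and [(1 - p) * w] for a
    common [w]. The left side sees [p * w], the expectation on the right sees the sum [w]. *)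
Lemma expect_edge e h : e \in edges G ->
  expect (fun F => (e \in F)%:R * h F) = p * expect (fun F => h (e |: F)).
Proof.
move=> eE; rewrite /expect.
rewrite (bigID (fun F => e \in F)) /= [X in _ + X]big1 ?addr0; last first.
  by move=> F /andP[_ /negbTE->]; rewrite mul0r mulr0.
rewrite [in RHS](bigID (fun F => e \in F)) /=.
rewrite [X in _ * (_ + X)](reindex_onto (fun F => F :\ e) (fun F => e |: F)) /=;
  last first.
  by move=> F /andP[_ h1]; rewrite setU1K.
rewrite [X in _ * (_ + X)](eq_bigl (fun F => (F \in powerset (edges G)) && (e \in F)));
  last first.
  move=> F; rewrite !powersetE !inE eqxx /= andbT.
  apply/idP/idP => [/andP[h1 /eqP h2]|/andP[h1 h2]].
    rewrite -h2 in_setU1 eqxx andbT subUset sub1set eE /=.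
    by rewrite (subset_trans _ h1) // subsetDl.
  by rewrite setD1K // eqxx andbT (subset_trans _ h1) // subsetDl.
rewrite -big_split mulr_sumr; apply: eq_bigr => F /andP[_ eF] /=.
rewrite eF mul1r setD1K // (setUidPr _) ?sub1set //.
rewrite /perc_weight !(bigD1 e eE) /= eF !inE eqxx /=.
rewrite [X in _ * _ + (_ * X) * _](eq_bigr (fun i => if i \in F then p else 1 - p)).
  by ring.
by move=> i /andP[_ h2]; rewrite !inE h2.
Qed.

(** By independence, conditioning on [S] being open amounts to adding [S]; the induction opens one
    edge at a time. *)
Lemma expect_subset S h : S \subset edges G ->
  expect (fun F => (S \subset F)%:R * h F) = p ^+ #|S| * expect (fun F => h (S :|: F)).
Proof.
move: {2}#|S| (erefl #|S|) => n; elim: n S h => [|n IH] S h cS SE.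
  rewrite (cards0_eq cS) cards0 expr0 mul1r; apply: eq_expect => F.
  by rewrite sub0set mul1r set0U.
have [e eS] : exists e, e \in S by apply/set0Pn; rewrite -card_gt0 cS.
have eE := subsetP SE _ eS.
have SE' : S :\ e \subset edges G by rewrite (subset_trans _ SE) // subsetDl.
have cS' : #|S :\ e| = n by move: cS; rewrite (cardsD1 e) eS => -[].
transitivity (expect (fun F => (e \in F)%:R * ((S :\ e \subset F)%:R * h F))).
  apply: eq_expect => F; rewrite mulrA -natrM mulnb -{1}(setD1K eS).
  by rewrite subUset sub1set.
rewrite expect_edge // (cardsD1 e S) eS exprS -mulrA; congr (_ * _).
transitivity (expect (fun F => (S :\ e \subset F)%:R * h (e |: F))).
  apply: eq_expect => F; congr (_%:R * _).
  congr nat_of_bool; apply/subsetP/subsetP => hs u uS; last first.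
    by rewrite in_setU1 hs ?orbT.
  by have := hs u uS; move: uS; rewrite !inE; case: eqP.
rewrite (IH _ (fun F => h (e |: F))) //; congr (_ * _).
by apply: eq_expect => F; rewrite setUA setD1K.
Qed.

Lemma expect_subset1 S : S \subset edges G ->
  expect (fun F => (S \subset F)%:R) = p ^+ #|S|.
Proof.
move=> SE; have := expect_subset (fun=> 1) SE; rewrite expect_cst mulr1 => <-.
by apply: eq_expect => F; rewrite mulr1.
Qed.

Section Monotone.
Hypothesis p01 : 0 <= p <= 1.

Lemma perc_weight_ge0 F : 0 <= perc_weight p F.
Proof.
have /andP[p0 p1] := p01.
by apply: prodr_ge0 => e _; case: ifP; rewrite ?subr_ge0.
Qed.

Lemma le_expect h h' : (forall F, h F <= h' F) -> expect h <= expect h'.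
Proof. by move=> hh; apply: ler_sum => F _; rewrite ler_wpM2l ?perc_weight_ge0. Qed.

(* [X] below is a centred sum of rescaled indicators, so [E[g X]] is the left
   hand side, while only intersecting pairs contribute to [Var X]; conclude by
   [g X <= (lam g^2 + X^2 / lam) / 2]. *)
Lemma influence_bound (I : finType) (Q : pred I) (S : I -> {set {set G}})
    (L : nat) (g : {set {set G}} -> R) (c lam : R) :
  0 < p -> 0 < lam -> (forall F, 0 <= g F <= c) ->
  (forall i, Q i -> S i \subset edges G) ->
  (forall i, Q i -> (#|S i| <= L)%N) ->
  \sum_(i | Q i) expect (fun F => g (S i :|: F) - g F) <=
  (lam * c ^+ 2 + lam^-1 * (p ^- L *
     #|[set u : I * I | [&& Q u.1, Q u.2 & S u.1 :&: S u.2 != set0]]|%:R)) / 2.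
Proof.
move=> p0 lam0 gc SE SL; have /andP[_ p1] := p01.
pose Y i F := p ^- #|S i| * (S i \subset F)%:R - 1.
pose X F := \sum_(i | Q i) Y i F.
have pn0 k : p ^+ k != 0 by rewrite expf_neq0 // gt_eqF.
have -> : \sum_(i | Q i) expect (fun F => g (S i :|: F) - g F) =
    expect (fun F => g F * X F).
  rewrite [RHS](@eq_expect _ (fun F => \sum_(i | Q i) g F * Y i F)); last first.
    by move=> F; rewrite mulr_sumr.
  rewrite expect_sum; apply: eq_bigr => i Qi; rewrite expectB.
  rewrite -[X in X - _](mulKf (pn0 #|S i|)) -expect_subset ?SE //.
  by rewrite -expectZ -expectB; apply: eq_expect => F; rewrite /Y; ring.
apply: (@le_trans _ _ ((lam * c ^+ 2 + lam^-1 * expect (fun F => X F * X F)) / 2)).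
  rewrite -(expect_cst (lam * c ^+ 2)) -expectZ -expectD mulrC -expectZ.
  apply: le_expect => F; have /andP[g0 g1] := gc F.
  have h1 : g F ^+ 2 <= c ^+ 2 by rewrite ler_pXn2r // nnegrE (le_trans g0).
  have h2 : 0 <= lam^-1 * (lam * g F - X F) ^+ 2.
    by rewrite mulr_ge0 ?sqr_ge0 // invr_ge0 ltW.
  have h3 : lam^-1 * (lam * g F - X F) ^+ 2 =
      lam * g F ^+ 2 - 2 * (g F * X F) + lam^-1 * (X F * X F).
    by field; rewrite gt_eqF.
  have h4 : lam * g F ^+ 2 <= lam * c ^+ 2 by rewrite ler_pM2l.
  by lra.
rewrite ler_pM2r ?invr_gt0 // lerD2l ler_pM2l ?invr_gt0 //.
(* Since [#|S i| + #|S j| = #|S i :|: S j| + #|S i :&: S j|], the normalised indicators leave only a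
   factor from the shared edges; disjoint sets have covariance 0. *)
have covE i j : Q i -> Q j ->
    expect (fun F => Y i F * Y j F) = p ^- #|S i :&: S j| - 1.
  move=> Qi Qj; pose a := p ^- #|S i|; pose d := p ^- #|S j|.
  rewrite (@eq_expect _ (fun F => a * d * (S i :|: S j \subset F)%:R
    - (a * (S i \subset F)%:R + (d * (S j \subset F)%:R - 1)))); last first.
    by move=> F; rewrite subUset -mulnb natrM /Y -/a -/d; ring.
  rewrite expectB expectD expectB !expectZ expect_cst.
  rewrite !expect_subset1 ?subUset ?SE // /a /d !mulVf // subrr addr0.
  congr (_ - _); have : p ^+ #|S i| * p ^+ #|S j|
      = p ^+ #|S i :|: S j| * p ^+ #|S i :&: S j|.
    by rewrite -!exprD cardsUI.
  by move=> e; rewrite -invfM e invfM mulrAC mulVf // mul1r.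
have -> : expect (fun F => X F * X F) =
    \sum_(u : I * I | Q u.1 && Q u.2) (p ^- #|S u.1 :&: S u.2| - 1).
  rewrite (@eq_expect _ (fun F => \sum_(i | Q i) \sum_(j | Q j) Y i F * Y j F));
    last first.
    by move=> F; rewrite mulr_suml; apply: eq_bigr => i _; rewrite mulr_sumr.
  rewrite expect_sum -(pair_big Q Q (fun i j => p ^- #|S i :&: S j| - 1)) /=.
  apply: eq_bigr => i Qi.
  by rewrite expect_sum; apply: eq_bigr => j Qj; rewrite covE.
rewrite (bigID (fun u : I * I => S u.1 :&: S u.2 == set0)) /= big1 ?add0r; last first.
  by move=> u /andP[_ /eqP->]; rewrite cards0 expr0 invr1 subrr.
rewrite mulr_natr -sumr_const [leRHS](eq_bigl
  (fun u : I * I => (Q u.1 && Q u.2) && (S u.1 :&: S u.2 != set0))); last first.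
  by move=> u; rewrite inE andbA.
apply: ler_sum => u /andP[/andP[Q1 Q2] _].
apply: (@le_trans _ _ (p ^- #|S u.1 :&: S u.2|)); first by rewrite gerBl.
rewrite lef_pV2 ?posrE ?exprn_gt0 // ler_wiXn2l ?(ltW p0) //.
by apply: leq_trans (SL _ Q1); rewrite subset_leq_card // subsetIl.
Qed.

End Monotone.
End Expectation.

(** * Connected pairs and the gain from joining two components *)

Section Connectivity.
Variable G : sgraph.
Implicit Types (x y z : G) (A B C : {set G}) (F S : {set {set G}}).

Definition conn F : {set G * G} := [set u | connect (sub_adj F) u.1 u.2].

Lemma connect_sub_adjC F x y :
  connect (sub_adj F) x y = connect (sub_adj F) y x.
Proof. exact: (sym_connect_sym (sub_adj_sym F)). Qed.

Lemma connect_sub_adj_mono F F' x y : F \subset F' ->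
  connect (sub_adj F) x y -> connect (sub_adj F') x y.
Proof.
move=> /subsetP FF'; apply: connect_sub => u v /andP[h1 h2].
by apply: connect1; rewrite /sub_adj /= h1 FF'.
Qed.

Lemma conn_mono F F' : F \subset F' -> conn F \subset conn F'.
Proof.
move=> FF'; apply/subsetP => u; rewrite !inE; exact: connect_sub_adj_mono.
Qed.

Lemma card_conn F : (#|conn F| <= #|G| ^ 2)%N.
Proof. by rewrite -mulnn -card_prod max_card. Qed.

Lemma components_spanning F C :
  C \in components (spanning_subgraph F) ->
  exists x, C = [set y | connect (sub_adj F) x y].
Proof.
by case/imsetP=> x _ ->; exists x; apply/setP => y; rewrite !inE.
Qed.

(** Components are classes of open connectivity, recast here as rectangles in [G * G] so that
    connected pairs can be counted. A connected pair across two classes would merge them. *)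
Lemma two_large_components (R : realType) (t : R) F :
  (1 < #|large_components t (spanning_subgraph F)|)%N ->
  exists A B, [/\ t <= #|A|%:R, t <= #|B|%:R,
    setX A A \subset conn F, setX B B \subset conn F
    & [disjoint setX A B & conn F]].
Proof.
case/card_gt1P=> A [B] [].
rewrite !inE => /andP[/components_spanning[x ->] tA].
case/andP=> /components_spanning[y ->] tB nAB.
exists [set z | connect (sub_adj F) x z], [set z | connect (sub_adj F) y z].
have sq z : setX [set v | connect (sub_adj F) z v]
                 [set v | connect (sub_adj F) z v] \subset conn F.
  apply/subsetP => -[u v]; rewrite !inE /= => /andP[h1 h2].
  by apply: connect_trans h2; rewrite connect_sub_adjC.
split => //; rewrite -setI_eq0; apply: contraNT nAB => /set0Pn[[u v]].
rewrite !inE /= => /andP[/andP[xu yv] uv].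
have xy : connect (sub_adj F) x y.
  apply: connect_trans xu (connect_trans uv _); by rewrite connect_sub_adjC.
apply/eqP/setP => z; rewrite !inE.
apply/idP/idP; apply: connect_trans => //; by rewrite connect_sub_adjC.
Qed.

(** The link from [x] to [y] connects every pair in [setX A B], and none of these pairs belonged to
    [conn F]. *)
Lemma conn_join F S A B x y :
  setX A A \subset conn F -> setX B B \subset conn F ->
  [disjoint setX A B & conn F] -> x \in A -> y \in B ->
  connect (sub_adj S) x y ->
  (#|conn F| + #|A| * #|B| <= #|conn (S :|: F)|)%N.
Proof.
move=> /subsetP AA /subsetP BB dis xA yB xy; rewrite addnC -cardsX.
move: dis; rewrite -setI_eq0 => /eqP dis.
have := cardsUI (setX A B) (conn F); rewrite dis cards0 addn0 => <-.
apply: subset_leq_card; rewrite subUset conn_mono ?subsetUr // andbT.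
apply/subsetP => -[u v]; rewrite !inE /= => /andP[uA vB].
have := AA (u, x); rewrite !inE /= uA xA => /(_ isT) ux.
have := BB (y, v); rewrite !inE /= yB vB => /(_ isT) yv.
apply: connect_trans (connect_sub_adj_mono (subsetUr _ _) ux) _.
apply: connect_trans (connect_sub_adj_mono (subsetUl _ _) xy) _.
exact: connect_sub_adj_mono (subsetUr _ _) yv.
Qed.

(** Serves to bound the number of nonzero covariances. After a free choice of the first vertex, the
    other three lie in balls of radii [L], [L + L] and [L], which add up to [4 * L]. *)
Lemma card_near_quadruple (D L : nat) : (max_degree G <= D)%N ->
  (#|[set u : (G * G) * (G * G) | [&& near L u.1.1 u.1.2, near L u.2.1 u.2.2 &
        near (L + L) u.1.1 u.2.1]]| <= #|G| * D.+1 ^ (4 * L))%N.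
Proof.
move=> hD; rewrite -sum1_card.
rewrite (eq_bigl (fun u : (G * G) * (G * G) => near L u.1.1 u.1.2 &&
  (near (L + L) u.1.1 u.2.1 && near L u.2.1 u.2.2))); last first.
  by move=> u; rewrite inE (andbC (near L u.2.1 _)).
rewrite -(pair_big_dep (fun i : G * G => near L i.1 i.2)
  (fun i j : G * G => near (L + L) i.1 j.1 && near L j.1 j.2) (fun _ _ => 1%N)) /=.
rewrite -(pair_big_dep xpredT (fun x y => near L x y)
  (fun x y => \sum_(j : G * G | near (L + L) x j.1 && near L j.1 j.2) 1)%N) /=.
have cst (P : pred G) c : (\sum_(y | P y) c = #|[set y | P y]| * c)%N.
  by rewrite sum_nat_const cardsE.
rewrite -sum_nat_const; apply: leq_sum => x _.
rewrite cst -(pair_big_dep (fun x' => near (L + L) x x')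
  (fun x' y' => near L x' y') (fun _ _ => 1%N)) /=.
have -> : (4 * L = L + ((L + L) + L))%N by lia.
rewrite expnD leq_mul ?card_near // expnD.
apply: (@leq_trans (\sum_(x' | near (L + L) x x') D.+1 ^ L)%N).
  by apply: leq_sum => x' _; rewrite cst muln1 card_near.
by rewrite cst leq_mul2r card_near ?orbT.
Qed.

End Connectivity.

(** * Two large components in an expander *)

Section Bounds.
Variables (R : realType) (G : sgraph) (p : R).
Hypothesis p01 : 0 <= p <= 1.

Lemma prob_two_large_expander (b t lam : R) (D k : nat) :
  0 < p -> 0 < b -> 0 < t -> 0 < lam ->
  vertex_expander b G -> (max_degree G <= D)%N ->
  #|G|%:R < (1 + b) ^+ k * t ->
  perc_prob G p (fun H => 1 < #|large_components t H|)%N * t ^+ 3 <=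
  lam * #|G|%:R ^+ 4 +
  lam^-1 * (p ^- (k + k) * (#|G|%:R * D.+1%:R ^+ (4 * (k + k)))).
Proof.
move=> p0 b0 t0 lam0 expG degG hk; set L := (k + k)%N.
(* One short path is fixed for each close pair; other pairs receive the empty set as a dummy
   value. *)
have /boolp.choice[S hS] : forall u : G * G, exists S : {set {set G}},
    near L u.1 u.2 ->
    [/\ S \subset edges G, (#|S| <= L)%N,
        (forall e v, e \in S -> v \in e -> near L u.1 v)
      & connect (sub_adj S) u.1 u.2].
  move=> u; have [h|h] := boolP (near L u.1 u.2); last by exists set0.
  by have [S hS] := near_path h; exists S.
pose g F : R := #|conn (G := G) F|%:R.
have gc F : 0 <= g F <= #|G|%:R ^+ 2.
  by rewrite ler0n /= -natrX ler_nat card_conn.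
have mono F u : 0 <= g (S u :|: F) - g F.
  by rewrite subr_ge0 ler_nat subset_leq_card // conn_mono // subsetUr.
have := influence_bound p01 p0 lam0 gc (Q := fun u => near L u.1 u.2)
  (fun u h => let: And4 h _ _ _ := hS u h in h)
  (fun u h => let: And4 _ h _ _ := hS u h in h).
set N := #|[set u | _]|; rewrite -expect_sum => bound.
(* An endpoint [c] of a shared edge lies within [L] of both starting points, so these are within
   [L + L] of each other. *)
have hN : (N <= #|G| * D.+1 ^ (4 * L))%N.
  apply: leq_trans (card_near_quadruple L degG).
  apply: subset_leq_card; apply/subsetP => -[u v]; rewrite !inE /=.
  case/and3P=> hu hv /set0Pn[e]; rewrite inE => /andP[eu ev].
  rewrite hu hv /=; have [SE _ nu _] := hS _ hu; have [_ _ nv _] := hS _ hv.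
  have /imsetP[[c d] _ /= ec] := subsetP SE _ eu.
  have ce : c \in e by rewrite ec !inE eqxx.
  exact: near_trans (nu _ _ eu ce) (near_sym (nv _ _ ev ce)).
rewrite -exprM in bound.
(* On the event, at least [t / 2] vertices [x] of [A] have some [y] in [B] within [L], and adding
   [S (x, y)] gains at least [t ^+ 2] connected pairs. All other terms are nonnegative by
   monotonicity. *)
have low : perc_prob G p (fun H => 1 < #|large_components t H|)%N * (t ^+ 3 / 2)
    <= expect p (fun F => \sum_(u | near L u.1 u.2) (g (S u :|: F) - g F)).
  rewrite perc_probE mulrC -expectZ; apply: le_expect => // F.
  have [|_] := boolP (1 < _)%N; last by rewrite mulr0 sumr_ge0.
  case/two_large_components=> A [B] [tA tB AA BB dis]; rewrite mulr1.
  have := many_near b0 expG t0 tA tB hk; set A' := [set x in A | _] => hA'.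
  rewrite (eq_bigr (fun u => g (S (u.1, u.2) :|: F) - g F)); last by case.
  rewrite -(pair_big_dep xpredT (fun x y => near L x y)
    (fun x y => g (S (x, y) :|: F) - g F)) /=.
  rewrite (bigID (fun x => x \in A')) /=.
  rewrite -[leLHS]addr0 lerD //; last by do 2!apply: sumr_ge0 => ? _.
  apply: (@le_trans _ _ (\sum_(x in A') t ^+ 2)).
    rewrite sumr_const -[leRHS]mulr_natl exprS mulrAC.
    by rewrite ler_wpM2r // exprn_ge0 // ltW.
  apply: ler_sum => x; rewrite inE => /andP[xA /existsP[y /andP[yB xy]]].
  rewrite (bigD1 y) //= -[leLHS]addr0 lerD //; last by apply: sumr_ge0.
  have [_ _ _ /= Sxy] := hS (x, y) xy.
  have := conn_join AA BB dis xA yB Sxy; rewrite -(ler_nat R) natrD natrM.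
  move=> h; rewrite lerBrDl; apply: le_trans h; rewrite lerD2l expr2.
  by rewrite ler_pM // ltW.
have := le_trans low bound; rewrite mulrA ler_pM2r ?invr_gt0 // => /le_trans; apply.
rewrite lerD2l ler_pM2l ?invr_gt0 // ler_pM2l ?invr_gt0 ?exprn_gt0 //.
by rewrite -natrX -natrM ler_nat.
Qed.

End Bounds.

(** * Open self-avoiding paths *)

Section SelfAvoidingPaths.
Variable G : sgraph.
Implicit Types (x y : G) (s : seq G) (F : {set {set G}}).

(** As in [path], the lists omit the starting vertex [x]. *)
Fixpoint walks (k : nat) x : seq (seq G) :=
  if k is k'.+1
  then flatten [seq [seq y :: s | s <- walks k' y] | y <- enum [set y | adj x y]]
  else [:: [::]].

Lemma mem_walks k x s : (s \in walks k x) = (size s == k) && path (@adj G) x s.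
Proof.
elim: k x s => [|k IH] x s /=; first by rewrite inE; case: s.
apply/flatten_mapP/andP => [[y yx /mapP[s' s's ->]]|].
  move: s's yx; rewrite IH mem_enum inE /= => /andP[/eqP-> ->] ->.
  by rewrite eqxx.
case: s => [|y s] [] //= hs /andP[xy hp]; exists y; first by rewrite mem_enum inE.
by apply: map_f; rewrite IH -eqSS hs.
Qed.

Lemma size_walks (D k : nat) x :
  (max_degree G <= D)%N -> (size (walks k x) <= D ^ k)%N.
Proof.
move=> hD; elim: k x => [|k IH] x //=.
rewrite size_flatten /shape -map_comp sumnE big_map.
apply: (@leq_trans (\sum_(y <- enum [set y | adj x y]) D ^ k)).
  by apply: leq_sum => y _ /=; rewrite size_map.
rewrite big_enum sum_nat_const expnS leq_mul2r; apply/orP; right.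
by apply: leq_trans hD; exact: (leq_bigmax x).
Qed.

Fixpoint path_edges x s : {set {set G}} :=
  if s is y :: s' then [set x; y] |: path_edges y s' else set0.

Lemma mem_path_edges x s e u :
  e \in path_edges x s -> u \in e -> u \in x :: s.
Proof.
elim: s x => [|y s IH] x /=; first by rewrite inE.
rewrite in_setU1 => /orP[/eqP->|eS ue].
  by rewrite !inE => /orP[] ->; rewrite ?orbT.
by rewrite inE (IH y) ?orbT.
Qed.

(** The first edge contains [x], which no later edge of a self-avoiding path does, so no edge
    repeats. *)
Lemma card_path_edges x s : uniq (x :: s) -> #|path_edges x s| = size s.
Proof.
elim: s x => [|y s IH] x; first by rewrite cards0.
rewrite cons_uniq => /andP[xs us]; rewrite /= cardsU1 IH //.
case: (boolP (_ \in _)) => //= h.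
by move: xs; rewrite (mem_path_edges h) // !inE eqxx.
Qed.

Lemma path_edges_sub x s : path (@adj G) x s -> path_edges x s \subset edges G.
Proof.
elim: s x => [|y s IH] x /=; first by rewrite sub0set.
case/andP=> xy hp; rewrite subUset IH // andbT sub1set.
by apply/imsetP; exists (x, y); rewrite ?inE.
Qed.

Lemma path_sub_adj F x s : path (sub_adj F) x s ->
  path (@adj G) x s /\ path_edges x s \subset F.
Proof.
elim: s x => [|y s IH] x /=; first by rewrite sub0set.
case/andP=> /andP[-> xyF] /IH[-> hs]; split => //.
by rewrite subUset hs sub1set xyF.
Qed.

(** Each vertex of the cluster ends an open path from [x], which can be shortened to a self-avoiding
    one, necessarily with fewer than [#|G|] edges. *)
Lemma card_cluster F x :
  (#|[set y | connect (sub_adj F) x y]| <=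
   \sum_(k < #|G|) \sum_(s <- walks k x | uniq (x :: s)) (path_edges x s \subset F))%N.
Proof.
pose W := flatten [seq walks k x | k <- iota 0 #|G|].
pose Q s := uniq (x :: s) && (path_edges x s \subset F).
apply: (@leq_trans (size [seq last x s | s <- W & Q s])).
  rewrite cardE; apply: uniq_leq_size; first exact: enum_uniq.
  move=> y; rewrite mem_enum inE => /connectP[s0 hs0 ->].
  case/shortenP: hs0 => s /path_sub_adj[ps sF] us _; apply: map_f.
  rewrite mem_filter /Q us sF /=; apply/flatten_mapP.
  exists (size s); last by rewrite mem_walks eqxx.
  rewrite mem_iota /= add0n; have /card_uniqP := us => /= <-; exact: max_card.
rewrite size_map size_filter -sum1_count big_flatten big_map.
rewrite -[iota _ _](_ : index_iota 0 #|G| = _); last by rewrite /index_iota subn0.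
rewrite big_mkord; apply: leq_sum => k _.
rewrite big_mkcondr /=; apply: leq_sum => s _; by case: (_ \subset _).
Qed.

End SelfAvoidingPaths.

(** * Expected cluster size for small [p] *)

Section Subcritical.
Variables (R : realType) (G : sgraph) (p : R).
Hypothesis p01 : 0 <= p <= 1.

Lemma sum_half_pow_le2 n : \sum_(k < n) (2^-1 : R) ^+ k <= 2.
Proof.
have -> : \sum_(k < n) (2^-1 : R) ^+ k = 2 - 2 * 2^-1 ^+ n.
  elim: n => [|n IH]; first by rewrite big_ord0 expr0; lra.
  by rewrite big_ord_recr /= IH exprS; field.
by rewrite gerBl mulr_ge0 // exprn_ge0 // invr_ge0.
Qed.

(** At most [D ^ k] walks of length [k] start at [x], and a self-avoiding one is open with
    probability [p ^+ k]; summing over [k] leaves a geometric series of ratio at most 1/2. *)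
Lemma expect_cluster_le2 (D : nat) (x : G) : (max_degree G <= D)%N ->
  p * D%:R <= 2^-1 ->
  expect p (fun F => #|[set y | connect (sub_adj F) x y]|%:R) <= 2.
Proof.
move=> hD pD; have /andP[p0 p1] := p01.
apply: le_trans (sum_half_pow_le2 #|G|).
apply: (@le_trans _ _ (expect p (fun F => \sum_(k < #|G|)
    \sum_(s <- walks k x | uniq (x :: s)) (path_edges x s \subset F)%:R))).
  apply: le_expect => // F; apply: (le_trans (y := (\sum_(k < #|G|)
    \sum_(s <- walks k x | uniq (x :: s)) (path_edges x s \subset F))%N%:R)).
    by rewrite ler_nat card_cluster.
  rewrite natr_sum ler_sum // => k _; by rewrite natr_sum.
rewrite expect_sum; apply: ler_sum => k _; rewrite expect_sum.
apply: (@le_trans _ _ (\sum_(s <- walks k x | uniq (x :: s)) p ^+ k)).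
  rewrite big_seq_cond [leRHS]big_seq_cond; apply: ler_sum => s.
  rewrite mem_walks => /andP[/andP[/eqP sk ps] us].
  by rewrite expect_subset1 ?path_edges_sub // card_path_edges // sk.
apply: (@le_trans _ _ (\sum_(s <- walks k x) p ^+ k)).
  rewrite big_mkcond /=; apply: ler_sum => s _; case: ifP => // _.
  exact: exprn_ge0.
rewrite big_const_seq count_predT iter_addr_0.
apply: (@le_trans _ _ ((p * D%:R) ^+ k)).
  rewrite exprMn -[leLHS]mulr_natr ler_wpM2l ?exprn_ge0 // -natrX ler_nat.
  exact: size_walks.
by rewrite lerXn2r ?nnegrE ?mulr_ge0 // ltW // invr_gt0.
Qed.

Lemma prob_two_large_subcritical (t : R) (D : nat) : 0 <= t ->
  (max_degree G <= D)%N -> p * D%:R <= 2^-1 ->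
  perc_prob G p (fun H => 1 < #|large_components t H|)%N * t ^+ 2 <=
  2 * #|G|%:R.
Proof.
move=> t0 hD pD.
(* Markov's inequality for the number of connected pairs, written as the sum of the cluster
   sizes. *)
apply: (@le_trans _ _ (expect p (fun F => \sum_(x : G)
   #|[set y | connect (sub_adj F) x y]|%:R))).
  rewrite perc_probE mulrC -expectZ; apply: le_expect => // F.
  have [|_] := boolP (1 < _)%N; last by rewrite mulr0 sumr_ge0.
  case/two_large_components=> A [B] [tA _ AA _ _]; rewrite mulr1.
  apply: (@le_trans _ _ #|conn F|%:R).
    apply: (@le_trans _ _ #|setX A A|%:R); last by rewrite ler_nat subset_leq_card.
    by rewrite cardsX natrM expr2 ler_pM.
  rewrite -natr_sum ler_nat -sum1_card.
  rewrite (eq_bigl (fun u : G * G => xpredT u.1 && connect (sub_adj F) u.1 u.2));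
    last by move=> u; rewrite inE.
  rewrite -(pair_big_dep xpredT (fun x y => connect (sub_adj F) x y)
    (fun _ _ => 1%N)) /=.
  by apply: leq_sum => x _; rewrite sum1_card cardsE.
rewrite expect_sum mulr_natr -sumr_const; apply: ler_sum => x _.
exact: expect_cluster_le2 hD pD.
Qed.

End Subcritical.

(** * Choice of the exponents *)

Section Asymptotics.
Variable R : realType.
Implicit Types (b x C : R).

Lemma exp1D_gt b x : 0 < b -> exists k, x < (1 + b) ^+ k.
Proof.
move=> b0; exists (Num.truncn (x / b)).+1; set k := _.+1.
have h : x < k%:R * b by rewrite -ltr_pdivrMr // truncnS_gt.
(* A form of Bernoulli's inequality: [j * b <= (1 + b) ^+ j]. *)
apply: lt_le_trans h _; elim: (k) => [|j IH]; first by rewrite mul0r expr0.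
have h1 : 1 <= (1 + b) ^+ j by rewrite exprn_ege1 // lerDl ltW.
have h2 : b <= b * (1 + b) ^+ j by rewrite ler_peMr // ltW.
by rewrite exprSr mulrDr mulr1 -natr1 mulrDl mul1r lerD // mulrC.
Qed.

(** The least [k] that works overshoots by a factor at most [1 + b]. The upper bound keeps costs
    exponential in the radius polynomial in [#|G|]. *)
Lemma exp1D_bracket b x : 0 < b -> 1 <= x ->
  exists2 k, x < (1 + b) ^+ k & (1 + b) ^+ k <= (1 + b) * x.
Proof.
move=> b0 x1; have [k hk kmin] := ex_minnP (exp1D_gt x b0); exists k => //.
case: k hk kmin => [|k] hk kmin; first by rewrite expr0 in hk; lra.
rewrite exprS ler_pM2l ?addr_gt0 // leNgt; apply/negP => /kmin.
by rewrite ltnn.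
Qed.

Lemma powRD_gt0 x r s : 0 < x -> x `^ (r + s) = x `^ r * x `^ s.
Proof. by move=> x0; rewrite powRD // (gt_eqF x0) implybT. Qed.

Lemma exprVM_double x d k :
  x ^- (k + k) * d ^+ (4 * (k + k)) = (x ^- 2 * d ^+ 8) ^+ k.
Proof. by rewrite exprMn -!exprVn -!exprM addnn -mul2n mulnA. Qed.

Lemma prob_two_large_le b (D : nat) : 0 < b ->
  exists omega C : R, [/\ omega < 1, 0 < C & forall (G : sgraph) (p : R),
    vertex_expander b G -> (max_degree G <= D)%N -> (0 < #|G|)%N ->
    0 <= p <= 1 ->
    perc_prob G p (fun H => 1 < #|large_components (#|G|%:R `^ omega) H|)%N <=
    C * #|G|%:R `^ (- 4^-1)].
Proof.
(* Threshold between the two regimes: below it [p * D] is at most 1/2, above it [p^-1] is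
   bounded. *)
move=> b0; pose p0 : R := (2 * D.+1%:R)^-1.
have D0 : 0 < D.+1%:R :> R by rewrite ltr0n.
have p00 : 0 < p0 by rewrite invr_gt0 mulr_gt0.
(* Variance cost per unit of [k]: the path length is [k + k] and the counting exponent
   [4 * (k + k)]. The exponent [a] below turns [M ^+ k] into a power of [(1 + b) ^+ k]. *)
pose M := p0 ^- 2 * D.+1%:R ^+ 8.
have M0 : 0 <= M by rewrite mulr_ge0 ?invr_ge0 ?exprn_ge0 // ltW.
have [a /ltW ha] := exp1D_gt M b0.
(* Chosen so that the final exponent [5 / 2 + a * eta - 3 * (1 - eta)] equals -1/4. *)
pose eta : R := (4 * (a%:R + 3))^-1.
have a0 : 0 <= a%:R :> R by [].
have eta0 : 0 < eta by rewrite invr_gt0; lra.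
have etaE : a%:R * eta + 3 * eta = 4^-1 by rewrite /eta; field; lra.
have aeta0 : 0 <= a%:R * eta by rewrite mulr_ge0 // ltW.
have b1a : 0 < (1 + b) ^+ a by rewrite exprn_gt0 // addr_gt0.
(* The summand 2 comes from the subcritical bound; the whole constant also dominates the
   coefficients 1 and [(1 + b) ^+ a] of the two terms of the expander bound. *)
exists (1 - eta), (2 + (1 + b) ^+ a); split; [lra|lra|].
move=> G p expG degG G0 p01; set N : R := #|G|%:R.
have N1 : 1 <= N by rewrite ler1n.
have N0 : 0 < N by apply: lt_le_trans N1.
have Np r : 0 < N `^ r by exact: powR_gt0.
have /andP[pge0 p1] := p01.
set t := N `^ (1 - eta); set P := perc_prob _ _ _.
have tX k : t ^+ k = N `^ ((1 - eta) * k%:R) by rewrite powRrM powR_mulrn ?powR_ge0.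
have NX k : N ^+ k = N `^ k%:R by rewrite powR_mulrn // ltW.
have [pp0|pp0] := leP p p0.
  have pD : p * D%:R <= 2^-1.
    apply: (@le_trans _ _ (p0 * D.+1%:R)).
      by rewrite ler_pM // ler_nat.
    by rewrite /p0 invfM -mulrA mulVf ?mulr1 // gt_eqF.
  have := prob_two_large_subcritical p01 (ltW (Np (1 - eta))) degG pD.
  rewrite -/N -/t -/P tX -ler_pdivlMr // => /le_trans; apply.
  rewrite -mulrA -powRN -{1}(powRr1 (ltW N0)) -powRD_gt0 // ler_pM //.
  - by rewrite ltW.
  - by rewrite lerDl ltW.
  - by rewrite ler_powR //; lra.
have N_eta : 1 <= N `^ eta by rewrite -(powRr0 N) ler_powR // ltW.
have [k hk1 hk2] := exp1D_bracket b0 N_eta.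
have hk : N < (1 + b) ^+ k * t.
  have {1}-> : N = N `^ eta * t.
    by rewrite /t -powRD_gt0 // addrC subrK powRr1 // ltW.
  by rewrite ltr_pM2r // Np.
(* Taking [lam] to be [N] to the power -3/2 balances [lam * N ^+ 4] against [lam^-1 * N], both then
   being [N] to the power 5/2. *)
have := prob_two_large_expander p01 (lt_trans p00 pp0) b0 (Np _) (Np (- (3 / 2)))
  expG degG hk.
rewrite -/N -/P tX -ler_pdivlMr // => /le_trans; apply.
have cost : p ^- (k + k) * D.+1%:R ^+ (4 * (k + k)) <=
    (1 + b) ^+ a * N `^ (a%:R * eta).
  apply: (@le_trans _ _ (M ^+ k)).
    have pV : p^-1 <= p0^-1.
      by rewrite lef_pV2 ?posrE ?(lt_trans p00 pp0) // ltW.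
    have pV2 : p ^- 2 <= p0 ^- 2.
      by rewrite -!exprVn lerXn2r ?nnegrE ?invr_ge0 // ltW.
    have D8 : 0 <= D.+1%:R ^+ 8 :> R by rewrite exprn_ge0.
    have pM : p ^- 2 * D.+1%:R ^+ 8 <= M by rewrite /M ler_wpM2r.
    rewrite exprVM_double; apply: lerXn2r pM; rewrite nnegrE //.
    by rewrite mulr_ge0 // invr_ge0 exprn_ge0.
  apply: (@le_trans _ _ (((1 + b) ^+ a) ^+ k)).
    by rewrite lerXn2r ?nnegrE // ltW.
  rewrite (mulrC _ eta) powRrM powR_mulrn ?powR_ge0 // -exprMn exprAC.
  by rewrite lerXn2r ?nnegrE ?mulr_ge0 ?exprn_ge0 // ltW // addr_gt0.
set B := (1 + b) ^+ a in b1a cost *.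
rewrite ler_pdivrMr // -mulrA -powRD_gt0 //.
rewrite (_ : - 4^-1 + (1 - eta) * 3%:R = 5 / 2 + a%:R * eta); last by lra.
have first_term : N `^ (- (3 / 2)) * N ^+ 4 <= N `^ (5 / 2 + a%:R * eta).
  by rewrite NX -powRD_gt0 // ler_powR //; lra.
have second_term : (N `^ (- (3 / 2)))^-1 *
    (p ^- (k + k) * (N * D.+1%:R ^+ (4 * (k + k)))) <=
    B * N `^ (5 / 2 + a%:R * eta).
  have NE : N `^ (3 / 2) * N = N `^ (5 / 2).
    by rewrite -{2}(powRr1 (ltW N0)) -powRD_gt0 //; congr (_ `^ _); lra.
  rewrite -powRN opprK powRD_gt0 //.
  rewrite [leLHS](_ : _ = N `^ (5 / 2) * (p ^- (k + k) * D.+1%:R ^+ (4 * (k + k)))).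
    by rewrite (mulrCA B) ler_pM2l.
  by rewrite -NE; ring.
have := Np (5 / 2 + a%:R * eta); lra.
Qed.

End Asymptotics.

(** * Passage to the limit *)

Local Open Scope classical_set_scope.

Theorem theorem2p8 (R : realType) (b : R) (Delta : nat) :
  0 < b ->
  exists omega : R, omega < 1 /\
    forall (G : nat -> sgraph) (p : nat -> R),
      (forall n, vertex_expander b (G n)) ->
      (forall n, (max_degree (G n) <= Delta)%N) ->
      #|G n| @[n --> \oo] --> \oo ->
      (forall n, 0 <= p n <= 1) ->
      perc_prob (G n) (p n)
        (fun H : sgraph =>
           (1 < #|large_components (#|G n|%:R `^ omega) H|)%N)
        @[n --> \oo] --> (0 : R).
Proof.
move=> b0; have [omega [C [omega1 C0 bound]]] := prob_two_large_le Delta b0.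
exists omega; split => // G p expG degG Goo p01.
(* Once [#|G n|] exceeds [K ^+ 4], the bound [C] times [#|G n|] to the power -1/4 is below [eps]. *)
apply/cvgr0Pnorm_lt => eps eps0; set K := C / eps.
have K0 : 0 < K by rewrite divr_gt0.
move/cvgnyPge: Goo => /(_ (Num.truncn (K ^+ 4)).+1); apply: filterS => n hn.
have N0 : (0 < #|G n|)%N by apply: leq_trans hn.
have hN : K ^+ 4 < #|G n|%:R.
  by apply: lt_le_trans (truncnS_gt _) _; rewrite ler_nat.
rewrite ger0_norm; last first.
  by apply: sumr_ge0 => F _; exact: perc_weight_ge0.
apply: le_lt_trans (bound _ _ (expG n) (degG n) N0 (p01 n)) _.
have Np : 0 < #|G n|%:R `^ 4^-1 :> R by rewrite powR_gt0 // ltr0n.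
rewrite powRN ltr_pdivrMr // mulrC -ltr_pdivrMr //.
rewrite ltNge; apply/negP => h; move: hN; rewrite ltNge => /negP; apply.
have -> : #|G n|%:R = (#|G n|%:R `^ 4^-1) ^+ 4 :> R.
  by rewrite -powR_mulrn ?powR_ge0 // -powRrM mulVf ?powRr1.
by rewrite lerXn2r ?nnegrE // ltW.
Qed.
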